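(* Let $n\ge 1$ and let $\alpha=(\alpha_{n-1},\alpha_{n-2},\ldots,\alpha_1,\alpha_0)\in\{0,1\}^n$, regarded as a hook sum vector (so the $k$-th hook sum is required to equal $\alpha_{n-k}$ for $1\le k\le n$). Let $w(\alpha)=\sum_{i=0}^{n-1} i\cdot\alpha_i$. Then the characteristic polynomial of the Tesler poset $P(\alpha)$ is $$\chi(P(\alpha);q)=(q-1)^{w(\alpha)}.$$
   Context: Let $U_n$ be the set of $n\times n$ upper-triangular matrices with nonnegative integer entries. For $A=(a_{i,j})\in U_n$ and $1\le k\le n$, the $k$-th hook sum is $h_k=(a_{k,k}+a_{k,k+1}+\cdots+a_{k,n})-(a_{1,k}+a_{2,k}+\cdots+a_{k-1,k})$, and $(h_1,\ldots,h_n)$ is the hook sum vector of $A$. For a vector $\beta\in\mathbb{Z}_{\ge 0}^n$, $\mathcal{T}(\beta)$ denotes the (finite) set of matrices in $U_n$ with hook sum vector $\beta$. The Tesler poset $P(\beta)$ is the partial order on $\mathcal{T}(\beta)$ that is the reflexive-transitive closure of the following cover relation: $A=(a_{ij})$ covers $B=(b_{ij})$ if either there exist $i<j<k$ with $a_{ij}=b_{ij}+1$, $a_{jk}=b_{jk}+1$, $a_{ik}=b_{ik}-1$ and all other entries equal, or there exist $i<j$ with $a_{ij}=b_{ij}+1$, $a_{jj}=b_{jj}+1$, $a_{ii}=b_{ii}-1$ and all other entries equal. Its least element $\hat0$ is the diagonal matrix whose diagonal is $\beta$. The rank of $A$ is $\rho(A)=\sum_{i<j}a_{ij}$ and $\rho(P(\beta))=\max_{A}\rho(A)$.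 The characteristic polynomial is $\chi(P;q)=\sum_{A\in P}\mu(\hat0,A)\,q^{\rho(P)-\rho(A)}$, where $\mu$ is the Möbius function of $P$. *)

(* Defs.v *)
From HB Require Import structures.
From mathcomp Require Import all_boot all_order all_algebra.
From mathcomp Require Import zify.

Set Implicit Arguments.
Unset Strict Implicit.
Unset Printing Implicit Defensive.

Import Order.TTheory GRing.Theory Num.Theory.
Local Open Scope ring_scope.

Section Mobius.
Variables (d : Order.disp_t) (P : finPOrderType d).

(* The fuel k bounds the length of the chains below y; #|P| always suffices,
   so that mobius satisfies the usual recursion (mobiusxx, mobius_lt and
   mobius_nle below). *)
Fixpoint mobius_rec (k : nat) (x y : P) : int :=
  if x == y then 1
  else if (x < y)%O then
    if k is k'.+1 then - \sum_(z : P | (x <= z)%O && (z < y)%O) mobius_rec k' x z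
    else 0
  else 0.

Definition mobius (x y : P) : int := mobius_rec #|P| x y.

Lemma mobiusxx (x : P) : mobius x x = 1.
Proof. by rewrite /mobius; case: #|P| => [|k] /=; rewrite eqxx. Qed.

Lemma mobius_nle (x y : P) : ~~ (x <= y)%O -> mobius x y = 0.
Proof.
rewrite le_eqVlt negb_or => /andP[/negPf xy /negPf xy'].
by rewrite /mobius; case: #|P| => [|k] /=; rewrite xy xy'.
Qed.

Lemma mobius_rec_fuel (k l : nat) (x y : P) :
  (#|[set z : P | (z < y)%O]| <= k)%N -> (#|[set z : P | (z < y)%O]| <= l)%N ->
  mobius_rec k x y = mobius_rec l x y.
Proof.
have lt_card (z t : P) : (z < t)%O ->
    (#|[set u : P | (u < z)%O]| < #|[set u : P | (u < t)%O]|)%N.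
  move=> zt; apply: proper_card; apply/properP; split.
    by apply/subsetP => u; rewrite !inE => /lt_trans; apply.
  by exists z; rewrite !inE ?ltxx.
elim: k l y => [|k IHk] [|l] y ky ly //=; case: eqVneq => // nxy;
  case: ifP => // xy.
- by have := leq_trans (lt_card _ _ xy) ky.
- by have := leq_trans (lt_card _ _ xy) ly.
congr (- _); apply: eq_bigr => z /andP[_ zy]; apply: IHk.
  exact: leq_trans (lt_card _ _ zy) ky.
exact: leq_trans (lt_card _ _ zy) ly.
Qed.

Lemma mobius_lt (x y : P) : (x < y)%O ->
  mobius x y = - \sum_(z : P | (x <= z)%O && (z < y)%O) mobius x z.
Proof.
move=> xy; rewrite /mobius (@mobius_rec_fuel #|P| #|P|.+1) ?max_card //=; last first.
  by rewrite (leq_trans (max_card _)).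
by rewrite lt_eqF // xy.
Qed.

End Mobius.

Section HookSums.
Variable n : nat.
Implicit Type A : 'M[nat]_n.

Definition upper_triangular A : bool :=
  [forall i : 'I_n, forall j : 'I_n, (j < i)%N ==> (A i j == 0%N)].

Definition hook_sum A (k : 'I_n) : int :=
  \sum_(j < n | (k <= j)%N) (A k j)%:Z - \sum_(i < n | (i < k)%N) (A i k)%:Z.

Definition is_tesler (b : 'I_n -> nat) A : bool :=
  upper_triangular A && [forall k : 'I_n, hook_sum A k == (b k)%:Z].

Definition rank_mx A : nat := (\sum_(i < n) \sum_(j < n | (i < j)%N) A i j)%N.

(* tesler_cover B A : A covers B. *)
Definition tesler_cover (B A : 'M[nat]_n) : bool :=
  [exists i : 'I_n, exists j : 'I_n, exists k : 'I_n,
    [&& (i < j)%N, (j < k)%N,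
        A i j == (B i j + 1)%N, A j k == (B j k + 1)%N, (A i k + 1)%N == B i k &
        [forall s : 'I_n, forall t : 'I_n,
          ((s, t) \notin [:: (i, j); (j, k); (i, k)]) ==> (A s t == B s t)]]]
  || [exists i : 'I_n, exists j : 'I_n,
    [&& (i < j)%N,
        A i j == (B i j + 1)%N, A j j == (B j j + 1)%N, (A i i + 1)%N == B i i &
        [forall s : 'I_n, forall t : 'I_n,
          ((s, t) \notin [:: (i, j); (j, j); (i, i)]) ==> (A s t == B s t)]]].

Lemma is_teslerP (b : 'I_n -> nat) A :
  reflect ((forall i j : 'I_n, (j < i)%N -> A i j = 0%N) /\
           (forall k, hook_sum A k = (b k)%:Z)) (is_tesler b A).
Proof.
apply: (iffP andP) => -[H1 H2]; split.
- by move=> i j ji; move/forallP/(_ i)/forallP/(_ j)/implyP/(_ ji)/eqP: H1.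
- by move=> k; move/forallP/(_ k)/eqP: H2.
- by apply/forallP => i; apply/forallP => j; apply/implyP => /H1 ->.
- by apply/forallP => k; apply/eqP.
Qed.

Lemma hook_sum_nat (b : 'I_n -> nat) A k : hook_sum A k = (b k)%:Z ->
  (\sum_(j < n | (k <= j)%N) A k j =
   b k + \sum_(i < n | (i < k)%N) A i k)%N.
Proof.
rewrite /hook_sum -!(big_morph Posz PoszD (erefl _)) => /eqP.
by rewrite subr_eq -PoszD => /eqP[].
Qed.

Lemma tesler_bound (b : 'I_n -> nat) A i j :
  is_tesler b A -> (A i j <= \sum_(k < n) b k)%N.
Proof.
move=> /is_teslerP[At Ab].
have [ji|ij] := ltnP j i; first by rewrite At.
have E : (\sum_(k < n | k <= i) \sum_(l < n | k <= l) A k l =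
    \sum_(k < n | k <= i) b k + \sum_(k < n | k <= i) \sum_(l < n | l < k) A l k)%N.
  by rewrite -big_split /=; apply: eq_bigr => k _; apply: hook_sum_nat.
have F : (A i j + \sum_(k < n | k <= i) \sum_(l < n | l < k) A l k <=
          \sum_(k < n | k <= i) \sum_(l < n | k <= l) A k l)%N.
  rewrite (exchange_big_dep (fun l : 'I_n => l <= i)%N) /=; last by move=> *; lia.
  rewrite (bigD1 i) //= [leqRHS](bigD1 i) //= addnA.
  apply: leq_add.
    rewrite [X in (_ + X)%N]big_pred0 ?addn0; last by move=> k; lia.
    by rewrite (bigD1 j) //= leq_addr.
  apply: leq_sum => k /andP[ki _].
  rewrite [leqRHS](bigID (fun l : 'I_n => (l <= i) && (k < l))%N) /=.
  apply: leq_trans (leq_addr _ _); rewrite leq_eqVlt; apply/orP; left; apply/eqP.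
  by apply: eq_bigl => l; lia.
have G : (\sum_(k < n | k <= i) b k <= \sum_(k < n) b k)%N.
  by rewrite [leqRHS](bigID (fun k : 'I_n => k <= i)%N) /= leq_addr.
lia.
Qed.

Lemma tesler_cover_rank (B A : 'M[nat]_n) :
  tesler_cover B A -> rank_mx A = (rank_mx B).+1.
Proof.
have rE (C : 'M[nat]_n) :
    rank_mx C = (\sum_(p : 'I_n * 'I_n | (p.1 < p.2)%N) C p.1 p.2)%N.
  by rewrite /rank_mx pair_big_dep.
have delta (c : 'I_n * 'I_n) :
    (\sum_(p : 'I_n * 'I_n | (p.1 < p.2)%N) (p == c) = (c.1 < c.2))%N.
  have [Hc|Hc] := boolP (c.1 < c.2)%N.
    rewrite (bigD1 c) //= eqxx big1 ?addn0 // => p /andP[_ /negPf ->] //.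
  rewrite big1 // => p Hp; case: eqP => // E; move: Hp; rewrite E.
  by rewrite (negPf Hc).
have key (c1 c2 c3 : 'I_n * 'I_n) :
    c1 != c2 -> c1 != c3 -> c2 != c3 ->
    A c1.1 c1.2 = (B c1.1 c1.2 + 1)%N -> A c2.1 c2.2 = (B c2.1 c2.2 + 1)%N ->
    (A c3.1 c3.2 + 1)%N = B c3.1 c3.2 ->
    (forall s t, (s, t) \notin [:: c1; c2; c3] -> A s t = B s t) ->
    (rank_mx A + (c3.1 < c3.2) = rank_mx B + (c1.1 < c1.2) + (c2.1 < c2.2))%N.
  move=> c12 c13 c23 H1 H2 H3 H; rewrite !rE -!delta -!big_split /=.
  apply: eq_bigr => p _; case: (eqVneq p c1) => [->|p1].
    by rewrite (negPf c12) (negPf c13) H1; lia.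
  case: (eqVneq p c2) => [->|p2]; first by rewrite (negPf c23) H2; lia.
  case: (eqVneq p c3) => [->|p3]; first by rewrite -H3; lia.
  rewrite H ?addn0 // -surjective_pairing !inE.
  by rewrite (negPf p1) (negPf p2) (negPf p3).
case/orP.
- case/existsP=> i /existsP[j /existsP[k]].
  case/and5P=> ij jk /eqP Aij /eqP Ajk /andP[/eqP Aik /forallP H].
  have /= := @key (i, j) (j, k) (i, k); rewrite ij jk (ltn_trans ij jk) => E.
  suff: (rank_mx A + 1 = rank_mx B + 1 + 1)%N by lia.
  apply: E => //; rewrite ?xpair_eqE -?(inj_eq val_inj) /=; try lia.
  by move=> s t st; move/(_ s)/forallP/(_ t)/implyP/(_ st)/eqP: H.
- case/existsP=> i /existsP[j].
  case/and5P=> ij /eqP Aij /eqP Ajj /eqP Aii /forallP H.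
  have /= := @key (i, j) (j, j) (i, i); rewrite ij !ltnn => E.
  suff: (rank_mx A + 0 = rank_mx B + 1 + 0)%N by lia.
  apply: E => //; rewrite ?xpair_eqE -?(inj_eq val_inj) /=; try lia.
  by move=> s t st; move/(_ s)/forallP/(_ t)/implyP/(_ st)/eqP: H.
Qed.

End HookSums.

Section TeslerPoset.
Variables (n : nat) (b : 'I_n -> nat).

Record tesler := Tesler {
  tesler_mx :> 'M[nat]_n;
  tesler_mxP : is_tesler b tesler_mx }.

HB.instance Definition _ := [isSub for tesler_mx].
HB.instance Definition _ := [Countable of tesler by <:].

Definition tesler_code (A : tesler) : 'M['I_(\sum_(k < n) b k).+1]_n :=
  map_mx inord (tesler_mx A).

Definition tesler_decode (M : 'M['I_(\sum_(k < n) b k).+1]_n) : option tesler :=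
  insub (map_mx (@nat_of_ord _) M).

Lemma tesler_codeK : pcancel tesler_code tesler_decode.
Proof.
move=> A; rewrite /tesler_decode; set M := map_mx _ _.
suff -> : M = tesler_mx A by rewrite valK.
apply/matrixP => i j; rewrite !mxE inordK // ltnS.
exact: tesler_bound (tesler_mxP A).
Qed.

HB.instance Definition _ : isFinite tesler := PCanIsFinite tesler_codeK.

Definition tesler_rank (A : tesler) : nat := rank_mx A.

Definition tesler_le : rel tesler :=
  connect (fun B A : tesler => tesler_cover B A).

Lemma tesler_le_refl : reflexive tesler_le.
Proof. exact: connect0. Qed.

Lemma tesler_le_trans : transitive tesler_le.
Proof. exact: connect_trans. Qed.

Lemma tesler_le_rank (B A : tesler) : tesler_le B A ->
  B = A \/ (tesler_rank B < tesler_rank A)%N.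
Proof.
case/connectP => p + ->; elim: p B => [|C p IHp] B /=; first by left.
move=> /andP[/tesler_cover_rank CB /IHp {}IHp]; right.
by case: IHp => [<-|]; rewrite /tesler_rank CB // => /ltnW.
Qed.

Lemma tesler_le_anti : antisymmetric tesler_le.
Proof.
move=> A B /andP[/tesler_le_rank[//|AB] /tesler_le_rank[//|BA]].
by have := ltn_trans AB BA; rewrite ltnn.
Qed.

Fact tesler_display : Order.disp_t. Proof. exact: Order.Disp tt tt. Qed.

HB.instance Definition _ := Order.Le_isPOrder.Build tesler_display tesler
  tesler_le_refl tesler_le_anti tesler_le_trans.

Definition tesler0_mx : 'M[nat]_n := \matrix_(i, j) (if i == j then b i else 0%N).

Lemma tesler0_mxP : is_tesler b tesler0_mx.
Proof.
apply/is_teslerP; split=> [i j ji|k].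
  by rewrite mxE; case: eqP => // ij; rewrite ij ltnn in ji.
rewrite /hook_sum (bigD1 k) //= mxE eqxx !big1 ?addr0 ?subr0 //.
  by move=> i ik; rewrite mxE; case: eqP => // E; rewrite E ltnn in ik.
by move=> j /andP[_ jk]; rewrite mxE eq_sym (negPf jk).
Qed.

Definition tesler0 : tesler := Tesler tesler0_mxP.

Lemma tesler0_le (A : tesler) : (tesler0 <= A)%O.
Proof.
have [m] := ubnP (tesler_rank A); elim: m A => // m IHm A rA.
have [At Ab] := is_teslerP _ _ (tesler_mxP A).
pose Q (p : 'I_n * 'I_n) := (p.1 < p.2)%N && (0 < A p.1 p.2)%N.
case: (pickP Q) => [p0 Qp0|noQ]; last first.
  suff -> : A = tesler0 by [].
  have A0 (s t : 'I_n) : (s < t)%N -> A s t = 0%N.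
    by move=> st; have := noQ (s, t); rewrite /Q /= st /=; lia.
  apply/val_inj/matrixP => s t /=; rewrite mxE; have [<-|nst] := eqVneq s t.
    have := hook_sum_nat (Ab s); rewrite (bigD1 s) //= big1; last first.
      by move=> u uP; apply: A0; move: uP; rewrite -(inj_eq val_inj) /=; lia.
    by rewrite big1 ?addn0 // => u /A0.
  by case: (ltngtP s t) => [/A0|/At|/val_inj E] //; rewrite E eqxx in nst.
case: (arg_maxnP (fun p : 'I_n * 'I_n => p.2 : nat) Qp0) => -[i j] /=.
rewrite /Q /= => /andP[ij Aij] jmax.
have Ajj : (0 < A j j)%N.
  have := hook_sum_nat (Ab j); rewrite (bigD1 j) //= big1; last first.
    move=> t; rewrite -(inj_eq val_inj) /= => tj.
    by have := jmax (j, t); rewrite /=; lia.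
  by rewrite (bigD1 i) //=; lia.
pose B : 'M[nat]_n := \matrix_(s, t)
  (if ((s, t) == (i, j)) || ((s, t) == (j, j)) then (A s t).-1
   else if (s, t) == (i, i) then (A s t).+1 else A s t).
have nij : i != j by rewrite -(inj_eq val_inj) /=; lia.
have BE s t : (B s t)%:Z = (A s t)%:Z - ((s, t) == (i, j))%:Z
    - ((s, t) == (j, j))%:Z + ((s, t) == (i, i))%:Z.
  rewrite mxE; case: (eqVneq (s, t) (i, j)) => [[-> ->]|_] /=.
    by rewrite !xpair_eqE -!(inj_eq val_inj) /=; lia.
  case: (eqVneq (s, t) (j, j)) => [[-> ->]|_] /=.
    by rewrite !xpair_eqE -!(inj_eq val_inj) /=; lia.
  by case: ifP => _ /=; lia.
have BT : is_tesler b B.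
  have rowd (k : 'I_n) (c : 'I_n * 'I_n) :
      \sum_(t < n | (k <= t)%N) ((k, t) == c)%:Z = ((k == c.1) && (k <= c.2)%N)%:Z.
    case: c => c1 c2 /=; case: (eqVneq k c1) => [->|kc] /=; last first.
      by rewrite big1 // => t _; rewrite xpair_eqE (negPf kc).
    have [kc|kc] := leqP c1 c2; last first.
      rewrite big1 // => t kt; rewrite xpair_eqE -!(inj_eq val_inj) /=; lia.
    rewrite (bigD1 c2) //= eqxx big1 ?addr0 // => t /andP[_ /negPf tc].
    by rewrite xpair_eqE tc andbF.
  have cold (k : 'I_n) (c : 'I_n * 'I_n) :
      \sum_(s < n | (s < k)%N) ((s, k) == c)%:Z = ((k == c.2) && (c.1 < k)%N)%:Z.
    case: c => c1 c2 /=; case: (eqVneq k c2) => [->|kc] /=; last first.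
      by rewrite big1 // => s _; rewrite xpair_eqE (negPf kc) andbF.
    have [kc|kc] := ltnP c1 c2; last first.
      rewrite big1 // => s ks; rewrite xpair_eqE -!(inj_eq val_inj) /=; lia.
    rewrite (bigD1 c1) //= eqxx big1 ?addr0 // => s /andP[_ /negPf sc].
    by rewrite xpair_eqE sc.
  apply/is_teslerP; split=> [s t ts|k].
    rewrite mxE (At _ _ ts) /=; case: ifP => // _; case: eqP => // -[si ti].
    by rewrite si ti ltnn in ts.
  rewrite -(Ab k) /hook_sum.
  under eq_bigr do rewrite BE.
  under [X in _ - X]eq_bigr do rewrite BE.
  rewrite !big_split /= !sumrN !rowd !cold /=.
  set X := \sum_(_ < n | _) _; set Y := \sum_(_ < n | _) _.
  case: (eqVneq k i) => [->|_]; last by case: (eqVneq k j) => [->|_] /=; lia.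
  by rewrite (negPf nij) /=; lia.
have BA : tesler_cover B A.
  apply/orP; right; apply/existsP; exists i; apply/existsP; exists j.
  have E s t := BE s t.
  apply/and5P; split=> //.
  - by have := E i j; rewrite !xpair_eqE -!(inj_eq val_inj) /=; lia.
  - by have := E j j; rewrite !xpair_eqE -!(inj_eq val_inj) /=; lia.
  - by have := E i i; rewrite !xpair_eqE -!(inj_eq val_inj) /=; lia.
  apply/forallP => s; apply/forallP => t; apply/implyP; rewrite !inE !negb_or.
  by case/and3P => /negPf h1 /negPf h2 /negPf h3; rewrite mxE h1 h2 h3.
apply: (@le_trans _ _ (Tesler BT : tesler)); last exact: (@connect1 _ _ (Tesler BT) A).
apply: IHm; move: rA; rewrite /tesler_rank (tesler_cover_rank BA) /=; lia.
Qed.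

Definition tesler_poset_rank : nat := \max_(A : tesler) tesler_rank A.

Definition tesler_char_poly : {poly int} :=
  \sum_(A : tesler) (mobius tesler0 A)%:P * 'X ^+ (tesler_poset_rank - tesler_rank A).

End TeslerPoset.

(* Main.v *)
(* Read a Tesler matrix as a flow on the vertices [0 .. n], with the diagonal
   entry [A i i] on the arc from [i] to the sink [n]: going up a cover replaces
   one unit on an arc [u -> t] by a unit on [u -> w -> t].  When the hook sums
   are 0 or 1, a unit issued from [s] follows a path to the sink given by an
   arbitrary set of intermediate vertices [w > s], so that subsets of the set of
   "detours" [(s, w)] map onto the Tesler poset.  This map [f] sends covers to
   covers and lifts covers.  For [A] other than the minimum, all [x] with
   [f x = A] share a detour, so the order ideal [{x | f x <= A}] is a cone and
   its alternating sum vanishes.  Hence [mu(0, A)] is the sum of [(-1)^|x|] over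
   the fibre of [A], and the characteristic polynomial is that of the Boolean
   lattice of all detours. *)
Require Import Defs.
From mathcomp Require Import all_boot all_order all_algebra.
From mathcomp Require Import zify.

Import Order.TTheory GRing.Theory Num.Theory.

Set Implicit Arguments.
Unset Strict Implicit.
Unset Printing Implicit Defensive.
Local Open Scope ring_scope.

(** * Consecutive elements of a set of natural numbers *)

Definition consecutive (V : pred nat) (a c : nat) : bool :=
  [&& V a, V c, (a < c)%N & [forall m : 'I_c, (a < m)%N ==> ~~ V m]].

Lemma consecutiveP (V : pred nat) a c :
  reflect [/\ V a, V c, (a < c)%N & forall m, (a < m < c)%N -> ~~ V m]
          (consecutive V a c).
Proof.
apply: (iffP and4P) => -[Va Vc ac H]; split=> //.
  move=> m /andP[am mc].
  by move/forallP/(_ (Ordinal mc))/implyP/(_ am): H.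
by apply/forallP => m; apply/implyP => am; rewrite H ?am ?ltn_ord.
Qed.

Lemma eq_consecutive (V V' : pred nat) : V =1 V' ->
  forall a c, consecutive V a c = consecutive V' a c.
Proof.
move=> E a c; rewrite /consecutive !E; congr [&& _, _, _ & _].
by apply: eq_forallb => m; rewrite E.
Qed.

Lemma next_consecutive (V : pred nat) a c :
  V a -> V c -> (a < c)%N -> exists2 t, consecutive V a t & (t <= c)%N.
Proof.
move=> Va Vc ac; have exP : exists t, (a < t)%N && V t by exists c; rewrite ac.
case: (ex_minnP exP) => t /andP[at_ Vt] tmin; exists t; last first.
  by apply: tmin; rewrite ac.
apply/consecutiveP; split=> // m /andP[am mt]; apply/negP => Vm.
by have := tmin m; rewrite am Vm leqNgt mt => /(_ isT).
Qed.

(** Take for [u] the largest element of [V] below [w]. Its successor is not [w], which is outside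
    [V], and not smaller, by maximality. *)
Lemma straddling_consecutive (V : pred nat) a w c :
  V a -> V c -> ~~ V w -> (a < w)%N -> (w < c)%N ->
  exists u t, [/\ consecutive V u t, (u < w)%N, (w < t)%N & (t <= c)%N].
Proof.
move=> Va Vc Vw aw wc.
have exP : exists u, (u < w)%N && V u by exists a; rewrite aw.
have ubP u : (u < w)%N && V u -> (u <= w)%N by case/andP=> /ltnW.
case: (ex_maxnP exP ubP) => u /andP[uw Vu] umax.
have [t tV tc] := next_consecutive Vu Vc (ltn_trans uw wc).
exists u, t; split=> //; case/consecutiveP: tV => _ Vt ut _.
rewrite ltnNge; apply/negP; rewrite leq_eqVlt => /orP[/eqP E|tw].
  by rewrite E (negPf Vw) in Vt.
by have := umax t; rewrite tw Vt leqNgt ut => /(_ isT).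
Qed.

Lemma consecutive_inj (V : pred nat) w a c u t :
  consecutive V a c -> (a < w < c)%N -> consecutive V u t -> (u < w < t)%N ->
  a = u /\ c = t.
Proof.
move=> /consecutiveP[Va Vc ac Hac] /andP[aw wc].
move=> /consecutiveP[Vu Vt ut Hut] /andP[uw wt]; split.
  case: (ltngtP a u) => // h.
    by have := Hac u; rewrite Vu h (ltn_trans uw wc) => /(_ isT).
  by have := Hut a; rewrite Va h (ltn_trans aw wt) => /(_ isT).
case: (ltngtP c t) => // h.
  by have := Hut c; rewrite Vc h (ltn_trans uw wc) => /(_ isT).
by have := Hac t; rewrite Vt h (ltn_trans aw wt) => /(_ isT).
Qed.

(** Inserting [w] into the gap from [u] to [t] splits that one arc in two and leaves every other arc
    alone. Terms are added on both sides so that no truncated subtraction occurs. *)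
Lemma consecutive_insert (V V' : pred nat) u w t a c :
  (forall m, V' m = V m || (m == w)) ->
  consecutive V u t -> (u < w)%N -> (w < t)%N ->
  (consecutive V' a c + ((a == u) && (c == t)) =
   consecutive V a c + ((a == u) && (c == w)) + ((a == w) && (c == t)))%N.
Proof.
move=> V'E Vut uw wt; have /consecutiveP[Vu Vt ut Hut] := Vut.
have Vw : V w = false by apply/negbTE/Hut; rewrite uw.
have Vuw : consecutive V' u w.
  apply/consecutiveP; split; rewrite ?V'E ?Vu ?eqxx ?orbT // => m /andP[um mw].
  by rewrite V'E negb_or Hut ?um ?(ltn_trans mw wt) //=; lia.
have Vwt : consecutive V' w t.
  apply/consecutiveP; split; rewrite ?V'E ?Vt ?eqxx ?orbT // => m /andP[wm mt].
  by rewrite V'E negb_or Hut ?mt ?(ltn_trans uw wm) //=; lia.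
have nVut : consecutive V' u t = false.
  apply/negbTE/negP => /consecutiveP[_ _ _ /(_ w)].
  by rewrite uw wt V'E eqxx orbT => /(_ isT).
have [aw|naw] := eqVneq a w.
  rewrite {a}aw (_ : (w == u) = false) ?andFb /=; last lia.
  have -> : consecutive V w c = false by rewrite /consecutive Vw.
  rewrite ?addn0 ?add0n; congr nat_of_bool; apply/idP/eqP => [|-> //].
  move=> /consecutiveP[_ V'c wc H].
  have Vc : V c by move: V'c; rewrite V'E; case: eqVneq wc => [->|_ _]; rewrite ?ltnn ?orbF.
  case: (ltngtP c t) => // h.
    by have := Hut c; rewrite Vc h (ltn_trans uw wc) => /(_ isT).
  by have := H t; rewrite V'E Vt wt h => /(_ isT).
rewrite addn0; have [cw|ncw] := eqVneq c w.
  rewrite {c}cw (_ : (w == t) = false) ?andbF ?andbT /=; last lia.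
  have -> : consecutive V a w = false by rewrite /consecutive Vw andbF.
  rewrite ?addn0 ?add0n; congr nat_of_bool; apply/idP/eqP => [|-> //].
  move=> /consecutiveP[V'a _ aw H].
  have Va : V a by move: V'a; rewrite V'E (negPf naw) orbF.
  case: (ltngtP a u) => // h.
    by have := H u; rewrite V'E Vu uw h => /(_ isT).
  by have := Hut a; rewrite Va h (ltn_trans aw wt) => /(_ isT).
rewrite andbF addn0; have [/andP[/eqP-> /eqP->]|E] := boolP ((a == u) && (c == t)).
  by rewrite nVut Vut.
rewrite addn0; congr nat_of_bool; apply/consecutiveP/consecutiveP.
  move=> [V'a V'c ac H]; split=> //.
  - by move: V'a; rewrite V'E (negPf naw) orbF.
  - by move: V'c; rewrite V'E (negPf ncw) orbF.
  - by move=> m /H; rewrite V'E negb_or => /andP[].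
move=> [Va Vc ac H]; split; rewrite ?V'E ?Va ?Vc // => m mac.
rewrite V'E negb_or H //=; apply/eqP => mw; rewrite mw in mac.
(* Gaps of [V] are disjoint, so a pair with [w] strictly inside is [(u, t)], which [E] excludes. *)
have [] := @consecutive_inj V w a c u t _ mac Vut; rewrite ?uw //.
  exact/consecutiveP.
by move=> au ct; rewrite au ct !eqxx in E.
Qed.

(** * Covers as the rerouting of one unit of flow *)

Section Refinement.
Variable n : nat.
Implicit Types (A B : 'M[nat]_n) (a c : 'I_n).

Definition target a c : nat := if a == c then n else c.

Lemma target_eq a c t :
  (target a c == t) =
  ((a == c :> nat) && (t == n)) || ((a != c :> nat) && (c == t :> nat)).
Proof.
rewrite /target -(inj_eq val_inj) /=.
by case: (eqVneq (a : nat) c) => _ /=; rewrite ?orbF // eq_sym.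
Qed.

(** A unit on [u -> t] is rerouted through [w]. The two kinds of cover are the cases [t < n] and
    [t = n] of this single relation. *)
Definition refines u w t B A : Prop := forall a c,
  (A a c + ((a == u :> nat) && (target a c == t)) =
   B a c + ((a == u :> nat) && (target a c == w)) +
   ((a == w :> nat) && (target a c == t)))%N.

Lemma cover_refines B A : tesler_cover B A ->
  exists u w t, [/\ (u < w)%N, (w < t)%N, (w < n)%N, (t <= n)%N & refines u w t B A].
Proof.
case/orP.
- case/existsP=> i /existsP[j /existsP[k]].
  case/and5P=> ij jk /eqP Aij /eqP Ajk /andP[/eqP Aik /forallP H].
  exists i, j, k; split=> //; first exact: ltnW.
  move=> a c; rewrite !target_eq; have := ltn_ord k; have := ltn_ord j.
  have [[-> ->]|] := eqVneq (a, c) (i, j); first lia.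
  have [[-> ->] _|] := eqVneq (a, c) (j, k); first lia.
  have [[-> ->] _ _|] := eqVneq (a, c) (i, k); first lia.
  move=> h1 h2 h3; move/(_ a)/forallP/(_ c)/implyP: H.
  rewrite !inE (negPf h1) (negPf h2) (negPf h3) => /(_ isT)/eqP ->.
  move: h1 h2 h3; rewrite !xpair_eqE -!(inj_eq val_inj) /=; clear -ij  jk.
  case: (eqVneq (a : nat) i) => [->|_] /=; first lia.
  by case: (eqVneq (a : nat) j) => [->|_] /=; lia.
- case/existsP=> i /existsP[j].
  case/and5P=> ij /eqP Aij /eqP Ajj /eqP Aii /forallP H.
  exists i, j, n; split=> // a c; rewrite !target_eq.
  have := ltn_ord j; have := ltn_ord c.
  have [[-> ->]|] := eqVneq (a, c) (i, j); first lia.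
  have [[-> ->] _|] := eqVneq (a, c) (j, j); first lia.
  have [[-> ->] _ _|] := eqVneq (a, c) (i, i); first lia.
  move=> h1 h2 h3; move/(_ a)/forallP/(_ c)/implyP: H.
  rewrite !inE (negPf h1) (negPf h2) (negPf h3) => /(_ isT)/eqP ->.
  move: h1 h2 h3; rewrite !xpair_eqE -!(inj_eq val_inj) /=; clear -ij .
  case: (eqVneq (a : nat) i) => [->|_] /=; first lia.
  by case: (eqVneq (a : nat) j) => [->|_] /=; lia.
Qed.

Lemma refines_cover u w t B A :
  (u < w)%N -> (w < t)%N -> (w < n)%N -> (t <= n)%N -> refines u w t B A ->
  tesler_cover B A.
Proof.
move=> uw wt wn tn H.
pose i := Ordinal (ltn_trans uw wn); pose j := Ordinal wn; apply/orP.
have [tn'|nt] := ltnP t n; [left|right; have {nt tn}tn : t = n by lia].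
- pose k := Ordinal tn'; apply/existsP; exists i; apply/existsP; exists j.
  apply/existsP; exists k; apply/and5P; split=> //; last (apply/andP; split).
  + by have := H i j; rewrite !target_eq /=; lia.
  + by have := H j k; rewrite !target_eq /=; lia.
  + by have := H i k; rewrite !target_eq /=; lia.
  apply/forallP => a; apply/forallP => c; apply/implyP; have := H a c.
  rewrite !target_eq !inE !xpair_eqE -!(inj_eq val_inj) /=; clear -uw wt tn'.
  case: (eqVneq (a : nat) u) => [->|_] /=; first lia.
  by case: (eqVneq (a : nat) w) => [->|_] /=; lia.
- apply/existsP; exists i; apply/existsP; exists j; apply/and5P; split=> //.
  + by have := H i j; rewrite !target_eq /=; lia.
  + by have := H j j; rewrite !target_eq /=; lia.
  + by have := H i i; rewrite !target_eq /=; lia.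
  apply/forallP => a; apply/forallP => c; apply/implyP; have := H a c.
  rewrite !target_eq !inE !xpair_eqE -!(inj_eq val_inj) /=.
  have := ltn_ord c; clear -uw wn tn.
  case: (eqVneq (a : nat) u) => [->|_] /=; first lia.
  by case: (eqVneq (a : nat) w) => [->|_] /=; lia.
Qed.

Lemma row_sum_arc u t (k : 'I_n) : (u < t <= n)%N ->
  \sum_(j < n | (k <= j)%N) ((k == u :> nat) && (target k j == t))%:Z =
  (k == u :> nat)%:Z.
Proof.
move=> /andP[ut tn]; have [ku|_] := eqVneq (k : nat) u; last first.
  by rewrite big1.
(* The arc [u -> t] sits in column [t], or on the diagonal when [t = n]. *)
have [c kc Hc] : exists2 c : 'I_n, (k <= c)%N &
    forall j : 'I_n, (target k j == t) = (j == c).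
  have [tn'|nt] := ltnP t n.
    exists (Ordinal tn'); first by rewrite /=; lia.
    by move=> j; rewrite target_eq -!(inj_eq val_inj) /=; lia.
  by exists k => // j; rewrite target_eq -!(inj_eq val_inj) /=; have := ltn_ord j; lia.
rewrite (bigD1 c) //= Hc eqxx big1 ?addr0 // => j /andP[_ jc].
by rewrite Hc (negPf jc).
Qed.

(** For [t = n] both sides vanish: an arc into the sink is inflow to no vertex of ['I_n]. *)
Lemma col_sum_arc u t (k : 'I_n) : (u < t <= n)%N ->
  \sum_(i < n | (i < k)%N) ((i == u :> nat) && (target i k == t))%:Z =
  (k == t :> nat)%:Z.
Proof.
move=> /andP[ut tn]; have [kt|kt] := eqVneq (k : nat) t; last first.
  rewrite big1 // => i ik; rewrite target_eq; lia.
have un : (u < n)%N by have := ltn_ord k; lia.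
rewrite (bigD1 (Ordinal un)) /=; last lia.
rewrite target_eq /= big1 ?addr0 => [|i /andP[_]]; first lia.
by rewrite -(inj_eq val_inj) /= => /negPf ->.
Qed.

(** A hook sum is outflow minus inflow. Rerouting keeps the outflow of [u] and the inflow of [t],
    and adds one to both the inflow and the outflow of [w]. *)
Lemma refines_tesler (b : 'I_n -> nat) u w t B A :
  (u < w)%N -> (w < t)%N -> (w < n)%N -> (t <= n)%N -> refines u w t B A ->
  is_tesler b B -> is_tesler b A.
Proof.
move=> uw wt wn tn H /is_teslerP[Bt Bb]; apply/is_teslerP; split=> [i j ji|k].
  have := H i j; rewrite (Bt _ _ ji) !target_eq; have := ltn_ord i; lia.
have HZ a c : (A a c)%:Z = (B a c)%:Z +
    ((a == u :> nat) && (target a c == w))%:Z +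
    ((a == w :> nat) && (target a c == t))%:Z -
    ((a == u :> nat) && (target a c == t))%:Z by have := H a c; lia.
rewrite -(Bb k) /hook_sum.
under eq_bigr do rewrite HZ.
under [X in _ - X]eq_bigr do rewrite HZ.
rewrite !big_split /= !sumrN.
have [ut wtn uwn] : [/\ u < t <= n, w < t <= n & u < w <= n]%N by split; lia.
rewrite !(row_sum_arc _ ut, row_sum_arc _ wtn, row_sum_arc _ uwn).
rewrite !(col_sum_arc _ ut, col_sum_arc _ wtn, col_sum_arc _ uwn).
set X := \sum_(_ < n | _) _; set Y := \sum_(_ < n | _) _; lia.
Qed.

Lemma refines_inj u w t B A A' :
  refines u w t B A -> refines u w t B A' -> A = A'.
Proof. by move=> H H'; apply/matrixP => a c; have := H a c; have := H' a c; lia. Qed.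

End Refinement.

(** * Moebius functions and signed sums over sets *)

(** As [x0] is the least element, the interval from [x0] to [y] is the whole ideal below [y];
    vanishing sums over these ideals are then the Moebius recursion. *)
Lemma mobius_unique (d : Order.disp_t) (P : finPOrderType d) (x0 : P)
    (g : P -> int) :
  (forall y, x0 <= y)%O -> g x0 = 1 ->
  (forall y, y != x0 -> \sum_(z | (z <= y)%O) g z = 0) ->
  forall y, mobius x0 y = g y.
Proof.
move=> x0P g0 gS y; have [m] := ubnP #|[set z : P | (z < y)%O]|.
elim: m y => // m IHm y; rewrite ltnS => ym.
have [->|ny] := eqVneq y x0; first by rewrite mobiusxx g0.
rewrite mobius_lt ?lt_neqAle ?x0P ?andbT 1?eq_sym //.
have := gS y ny; rewrite (bigD1 y) //= => /eqP; rewrite addr_eq0 => /eqP ->.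
congr (- _); apply: eq_big => [z|z]; first by rewrite x0P lt_neqAle /= andbC.
move=> /andP[_ zy]; apply: IHm; apply: leq_trans ym; apply: proper_card.
apply/properP; split; last by exists z; rewrite !inE ?ltxx.
by apply/subsetP => u; rewrite !inE => /lt_trans; apply.
Qed.

Section SetSums.
Variable T : finType.
Implicit Types (p : T) (x D : {set T}).

Lemma subset_ind D (Q : {set T} -> Prop) :
  Q set0 ->
  (forall p x, p \in D -> p \notin x -> x \subset D -> Q x -> Q (p |: x)) ->
  forall x, x \subset D -> Q x.
Proof.
move=> Q0 QS x; have [m] := ubnP #|x|; elim: m x => // m IHm x xm xD.
have [->//|[p px]] := set_0Vmem x.
rewrite -(setD1K px); have sxD : x :\ p \subset D.
  by apply: subset_trans xD; apply: subD1set.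
apply: QS => //; [exact: (subsetP xD)|by rewrite !inE eqxx|].
by apply: IHm => //; move: xm; rewrite (cardsD1 p x) px.
Qed.

(** Toggling [p] is an involution that preserves [I] and reverses the sign. *)
Lemma alternating_cone p (I : pred {set T}) :
  (forall x, p \notin x -> I (p |: x) = I x) ->
  \sum_(x | I x) (-1) ^+ #|x| = 0 :> int.
Proof.
move=> IP; pose h x := if p \in x then x :\ p else p |: x.
have hK : involutive h.
  move=> x; rewrite {2}/h; case: ifP => px; rewrite /h !inE eqxx /=.
    by rewrite setD1K.
  by rewrite setU1K ?px.
set S := LHS; suff : S = - S by lia.
rewrite {1}/S (reindex_inj (inv_inj hK)) /= -sumrN /h; apply: eq_big => x.
  case: ifPn => px; last exact: IP.
  by rewrite -{2}(setD1K px) IP // !inE eqxx.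
move=> _; case: ifPn => px; last by rewrite cardsU1 px exprS mulN1r.
by rewrite (cardsD1 p x) px exprS mulN1r opprK.
Qed.

(** The characteristic polynomial of a Boolean lattice: the binomial theorem, with subsets grouped
    by cardinality. *)
Lemma sum_subsets_sign D :
  \sum_(x : {set T} | x \subset D) ((-1) ^+ #|x|)%:P * 'X ^+ (#|D| - #|x|) =
  ('X - 1) ^+ #|D| :> {poly int}.
Proof.
rewrite exprDn (partition_big (fun x : {set T} => inord #|x| : 'I_#|D|.+1) xpredT) //=.
apply: eq_bigr => i _.
rewrite (eq_bigr (fun=> 'X ^+ (#|D| - i) * (-1) ^+ i)) => [|x /andP[xD /eqP<-]].
  rewrite big_const iter_addr addr0 -cards_draws; congr (_ *+ _).
  apply: eq_card => x; rewrite !inE unfold_in; have [xD|//] := boolP (x \subset D).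
  by rewrite -(inj_eq val_inj) /= inordK // ltnS subset_leq_card.
by rewrite inordK ?ltnS ?subset_leq_card // mulrC -polyCN -polyC_exp.
Qed.

End SetSums.

(** * Flows carried by a family of paths *)

Section Paths.
Variables (n : nat) (b : 'I_n -> nat).
Implicit Types (x y : {set 'I_n * 'I_n}) (s w : 'I_n).

(** The path of the unit issued from [s], given by its vertex set; its arcs are the consecutive
    pairs. It lives on [nat] to make room for the sink [n]. *)
Definition visits x s : pred nat := fun m =>
  [|| m == n, m == s | [exists p in x, (p.1 == s) && (m == p.2)]].

Lemma visits_ord x s w : visits x s w = (w == s) || ((s, w) \in x).
Proof.
rewrite /visits ltn_eqF //=; congr (_ || _).
apply/existsP/idP => [[[s' w'] /and3P[px /eqP E /eqP]]|swx].
  by rewrite -E => /val_inj->.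
by exists (s, w); rewrite swx !eqxx.
Qed.

Lemma visitsU1 x s w s' m :
  visits ((s, w) |: x) s' m = visits x s' m || ((s == s') && (m == w)).
Proof.
rewrite /visits -!orbA; do 2!congr (_ || _).
apply/existsP/orP => [[p /andP[]]|[/existsP[p /andP[px H]]|H]].
- rewrite !inE => /orP[/eqP->|px H]; first by right.
  by left; apply/existsP; exists p; rewrite px.
- by exists p; rewrite !inE px orbT.
- by exists (s, w); rewrite !inE eqxx.
Qed.

Definition detours : {set 'I_n * 'I_n} :=
  [set p : 'I_n * 'I_n | (p.1 < p.2)%N && (b p.1 == 1%N)].

Definition flow x : 'M[nat]_n :=
  \matrix_(a, c) (\sum_s b s * consecutive (visits x s) a (target a c))%N.

(** Without detours every unit goes straight from its source to the sink. *)
Lemma flow0 : flow set0 = tesler0_mx b.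
Proof.
apply/matrixP => a c; rewrite !mxE (bigD1 a) //= big1 ?addn0 => [|s sa].
  have visE m : visits set0 a m = (m == n) || (m == a).
    rewrite /visits; case: existsP; rewrite ?orbF // => -[p].
    by rewrite inE.
  have an := ltn_ord a; have cn := ltn_ord c.
  case: eqVneq => [<-|ac].
    suff -> : consecutive (visits set0 a) a (target a a) by rewrite muln1.
    rewrite /target eqxx; apply/consecutiveP; rewrite !visE !eqxx ?orbT; split=> //.
    by move=> m; rewrite visE; lia.
  suff -> : consecutive (visits set0 a) a (target a c) = false by rewrite muln0.
  apply/negbTE/negP => /consecutiveP[_]; rewrite visE.
  by move: ac; rewrite /target -(inj_eq val_inj) /= => /negPf->; lia.
suff -> : consecutive (visits set0 s) a (target a c) = false by rewrite muln0.
by rewrite /consecutive visits_ord in_set0 orbF eq_sym (negPf sa).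
Qed.

(** Only the path from [s] changes, and it carries exactly one unit. *)
Lemma flow_insert x s w u t : b s = 1%N ->
  consecutive (visits x s) u t -> (u < w)%N -> (w < t)%N ->
  refines u w t (flow x) (flow ((s, w) |: x)).
Proof.
move=> bs ut uw wt a c; rewrite !mxE (bigD1 s) //= [in RHS](bigD1 s) //=.
rewrite (eq_bigr (fun s' =>
    b s' * consecutive (visits x s') a (target a c))%N) => [|s' ss']; last first.
  congr (_ * nat_of_bool _)%N; apply: eq_consecutive => m.
  by rewrite visitsU1 eq_sym (negPf ss') orbF.
rewrite bs !mul1n; set X := (\sum_(_ | _) _)%N.
have := @consecutive_insert _ (visits ((s, w) |: x) s) u w t a (target a c) _ ut uw wt.
move=> E; rewrite addnAC E; last by move=> m; rewrite visitsU1 eqxx.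
by lia.
Qed.

Lemma flow_step x s w : (s, w) \in detours -> (s, w) \notin x ->
  exists u t, [/\ (u < w)%N, (w < t)%N, (t <= n)%N &
                  refines u w t (flow x) (flow ((s, w) |: x))].
Proof.
rewrite inE /= => /andP[sw /eqP bs] swx.
have Vs : visits x s s by rewrite visits_ord eqxx.
have Vn : visits x s n by rewrite /visits eqxx.
have Vw : ~~ visits x s w by rewrite visits_ord negb_or swx andbT -(inj_eq val_inj) gtn_eqF.
have [u [t [ut uw wt tn]]] := straddling_consecutive Vs Vn Vw sw (ltn_ord w).
by exists u, t; split=> //; apply: flow_insert.
Qed.

Lemma flow_cover x p : p \in detours -> p \notin x ->
  tesler_cover (flow x) (flow (p |: x)).
Proof.
case: p => s w pD px; have [u [t [uw wt tn H]]] := flow_step pD px.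
exact: refines_cover H.
Qed.

Lemma flow_tesler x : x \subset detours -> is_tesler b (flow x).
Proof.
move: x; apply: subset_ind => [|[s w] x pD px xD].
  by rewrite flow0; apply: tesler0_mxP.
have [u [t [uw wt tn H]]] := flow_step pD px.
exact: refines_tesler H.
Qed.

Hypothesis b01 : forall s, (b s <= 1)%N.

(** A positive entry is an arc used by some path; vertices only increase along it, hence
    [s <= a]. *)
Lemma flow_pos x (a c : 'I_n) : x \subset detours -> (0 < flow x a c)%N ->
  exists s, [/\ b s = 1%N, (s <= a)%N & consecutive (visits x s) a (target a c)].
Proof.
move=> xD; rewrite mxE lt0n sum_nat_eq0 negb_forall => /existsP[s] /=.
rewrite muln_eq0 negb_or eqb0 negbK => /andP[bs sV]; exists s; split=> //.
  by have := b01 s; lia.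
case/consecutiveP: sV; rewrite visits_ord => /orP[/eqP->//|/(subsetP xD)].
by rewrite inE => /andP[/ltnW].
Qed.

(** The cover removes a unit from [u -> t], so some path uses this arc; sending that path through
    [w] has the same effect on the matrix. Several paths may qualify, so the lift need not be
    unique. *)
Lemma flow_lift x C : x \subset detours -> tesler_cover (flow x) C ->
  exists p, [/\ p \in detours, p \notin x & C = flow (p |: x)].
Proof.
move=> xD /cover_refines[u [w [t [uw wt wn tn H]]]].
pose i := Ordinal (ltn_trans uw wn); pose j := Ordinal wn.
have [c ct] : exists c, target i c = t.
  have [tn'|nt] := ltnP t n.
    by exists (Ordinal tn'); apply/eqP; rewrite target_eq /=; lia.
  by exists i; apply/eqP; rewrite target_eq /=; lia.
have [|s [bs si]] := @flow_pos x i c xD.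
  (* At this entry the relation reads [C i c + 1 = flow x i c]. *)
  by have := H i c; rewrite ct /=; lia.
rewrite ct /= => ut; exists (s, j).
have pD : (s, j) \in detours by rewrite inE /= bs eqxx andbT; move: si => /=; lia.
have px : (s, j) \notin x.
  case/consecutiveP: ut => _ _ _ /(_ w); rewrite uw wt => /(_ isT).
  by have := visits_ord x s j => /= ->; rewrite negb_or => /andP[].
split=> //; apply: refines_inj H _.
exact: (@flow_insert x s j).
Qed.

(** * The map from sets of detours onto the Tesler poset *)

(** The default [tesler0 b] only serves to make the map total; the lemmas about it concern subsets
    of [detours]. *)
Definition path_tesler x : tesler b := insubd (tesler0 b) (flow x).

Lemma path_teslerE x : x \subset detours -> path_tesler x = flow x :> 'M_n.
Proof. by move=> xD; rewrite /path_tesler val_insubd flow_tesler. Qed.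

Lemma path_tesler0 : path_tesler set0 = tesler0 b.
Proof. by apply: val_inj; rewrite /= path_teslerE ?sub0set // flow0. Qed.

Lemma path_tesler_cover x p : p \in detours -> x \subset detours -> p \notin x ->
  tesler_cover (path_tesler x) (path_tesler (p |: x)).
Proof.
move=> pD xD px; rewrite !path_teslerE //; first exact: flow_cover.
by rewrite subUset sub1set pD.
Qed.

Lemma path_tesler_rank x : x \subset detours -> tesler_rank (path_tesler x) = #|x|.
Proof.
move: x; apply: subset_ind => [|p x pD px xD IH].
  rewrite path_tesler0 cards0 /tesler_rank /rank_mx big1 // => i _.
  rewrite big1 // => j ij; rewrite mxE; case: eqP => // E.
  by rewrite E ltnn in ij.
by rewrite cardsU1 px -IH /tesler_rank (tesler_cover_rank (path_tesler_cover pD xD px)).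
Qed.

Lemma path_tesler_homo x y : x \subset y -> y \subset detours ->
  (path_tesler x <= path_tesler y)%O.
Proof.
move=> xy yD; have xD := subset_trans xy yD; rewrite -(setUidPr xy).
move: y yD {xy}; apply: subset_ind => [|p y pD py yD IH]; first by rewrite setU0.
(* Adding [p] to [x :|: y] changes nothing if [p] is already there, and is a cover otherwise. *)
apply: le_trans IH _; rewrite setUCA; have [pxy|pxy] := boolP (p \in x :|: y).
  by have /setUidPr-> : [set p] \subset x :|: y by rewrite sub1set.
by apply: connect1; apply: path_tesler_cover; rewrite // subUset xD.
Qed.

(** A chain of covers up to [A] is lifted one cover at a time by [flow_lift]. *)
Lemma path_tesler_lift x (A : tesler b) : x \subset detours ->
  (path_tesler x <= A)%O ->
  exists y, [/\ x \subset y, y \subset detours & path_tesler y = A].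
Proof.
move=> xD /connectP[q + ->]; elim: q x xD => [|C q IHq] x xD /=.
  by move=> _; exists x; split.
case/andP; rewrite path_teslerE // => /(flow_lift xD)[p [pD px CE]] qP.
have pxD : p |: x \subset detours by rewrite subUset sub1set pD.
have CF : C = path_tesler (p |: x) by apply: val_inj; rewrite /= path_teslerE.
rewrite CF in qP *; have [y [xy yD <-]] := IHq _ pxD qP.
by exists y; split=> //; apply: subset_trans xy; apply: subsetUr.
Qed.

Lemma path_tesler_surj (A : tesler b) :
  exists2 x : {set 'I_n * 'I_n}, x \subset detours & path_tesler x = A.
Proof.
have [|x [_ xD xA]] := @path_tesler_lift set0 A (sub0set _); last by exists x.
by rewrite path_tesler0; apply: tesler0_le.
Qed.

(* If [i] is the first row of [A] with an off-diagonal entry, then the unit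
   that leaves [i] starts there, as nothing can flow into [i]. *)
Lemma common_detour (A : tesler b) : A != tesler0 b ->
  exists2 p, p \in detours &
    forall y, y \subset detours -> path_tesler y = A -> p \in y.
Proof.
move=> nA; have rA : (0 < tesler_rank A)%N.
  case: (tesler_le_rank (tesler0_le A)) => [E|]; first by rewrite E eqxx in nA.
  by move/(leq_ltn_trans _); apply.
pose Q (p : 'I_n * 'I_n) := (p.1 < p.2)%N && (0 < A p.1 p.2)%N.
have [p0 Qp0] : exists p, Q p.
  move: rA; rewrite /tesler_rank /rank_mx pair_big_dep lt0n sum_nat_eq0.
  rewrite negb_forall => /existsP[p]; rewrite negb_imply -lt0n => pQ.
  by exists p.
case: (arg_minnP (fun p : 'I_n * 'I_n => p.1 : nat) Qp0) => -[i j] /=.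
rewrite /Q /= => /andP[ij Aij] imin.
have targij : target i j = j by rewrite /target -(inj_eq val_inj) /= ltn_eqF.
have source y : y \subset detours -> path_tesler y = A ->
    b i = 1%N /\ consecutive (visits y i) i j.
  move=> yD yA; have AE : tesler_mx A = flow y by rewrite -yA path_teslerE.
  have [|s [bs si sV]] := @flow_pos y i j yD; first by rewrite -AE.
  suff E : s = i by rewrite E targij in bs sV *.
  apply/val_inj/eqP; rewrite eqn_leq si leqNgt /=; apply/negP => ltsi.
  have Vs : visits y s s by rewrite visits_ord eqxx.
  have /consecutiveP[Vi _ _ _] := sV.
  (* A path starting at [s < i] would leave [s] by an arc to some [t <= i], an off-diagonal entry in
     a row before [i]. *)
  have [t tV ti] := next_consecutive Vs Vi ltsi.
  have tn : (t < n)%N by apply: leq_ltn_trans ti _.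
  have /consecutiveP[_ _ st _] := tV.
  have : Q (s, Ordinal tn).
    rewrite /Q /= st AE mxE (bigD1 s) //= bs.
    have -> : target s (Ordinal tn) = t.
      by rewrite /target -(inj_eq val_inj) /= ltn_eqF.
    by rewrite tV.
  by move/imin; rewrite /= leqNgt ltsi.
have [y0 y0D y0A] := path_tesler_surj A; have [bi _] := source y0 y0D y0A.
exists (i, j); first by rewrite inE /= ij bi.
move=> y yD yA; have [_ /consecutiveP[_ + _ _]] := source y yD yA.
by rewrite visits_ord -(inj_eq val_inj) /= gtn_eqF.
Qed.

(** * The Moebius function and the characteristic polynomial *)

Lemma mobius_tesler (A : tesler b) :
  mobius (tesler0 b) A =
  \sum_(x : {set 'I_n * 'I_n} | (x \subset detours) && (path_tesler x == A)) (-1) ^+ #|x|.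
Proof.
move: A; apply: mobius_unique => [A||A nA]; first exact: tesler0_le.
  (* Rank equals cardinality, so the fibre over the minimum is [set0] alone. *)
  rewrite (big_pred1 set0) ?cards0 // => x; apply/andP/eqP => [[xD /eqP x0]|->].
    apply: cards0_eq; rewrite -path_tesler_rank // x0 -path_tesler0.
    by rewrite path_tesler_rank ?sub0set // cards0.
  by rewrite sub0set path_tesler0.
transitivity (\sum_(x : {set 'I_n * 'I_n} | (x \subset detours) && (path_tesler x <= A)%O)
    (-1) ^+ #|x| : int).
  rewrite [RHS](partition_big path_tesler (fun B => B <= A)%O) => [|x /andP[]//].
  apply: eq_bigr => B BA; apply: eq_bigl => x.
  by case: eqP => [->|_]; rewrite ?BA ?andbT ?andbF.
have [p pD pP] := common_detour nA; apply: (@alternating_cone _ p) => x px.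
rewrite subUset sub1set pD /=; have [xD|//] := boolP (x \subset detours).
apply/idP/idP => [|xA].
  apply: le_trans; apply: path_tesler_homo; first exact: subsetUr.
  by rewrite subUset sub1set pD.
(* Some [y] containing [x] lies over [A] and so contains [p]; hence [p |: x] is a subset of [y] and
   stays in the ideal. *)
have [y [xy yD yA]] := path_tesler_lift xD xA; rewrite -yA.
by apply: path_tesler_homo => //; rewrite subUset sub1set xy pP.
Qed.

Lemma tesler_poset_rankE : tesler_poset_rank b = #|detours|.
Proof.
apply/eqP; rewrite eqn_leq; apply/andP; split.
  apply/bigmax_leqP => A _; have [x xD <-] := path_tesler_surj A.
  by rewrite path_tesler_rank // subset_leq_card.
by rewrite -(path_tesler_rank (subxx _)); apply: leq_bigmax.
Qed.

Lemma tesler_char_polyE : tesler_char_poly b = ('X - 1) ^+ #|detours|.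
Proof.
rewrite -sum_subsets_sign (partition_big path_tesler xpredT) //=.
apply: eq_bigr => A _; rewrite mobius_tesler raddf_sum big_distrl /=.
apply: eq_bigr => x /andP[xD /eqP<-].
by rewrite tesler_poset_rankE path_tesler_rank.
Qed.

(** There are [n - s.+1] vertices above [s], and [b s], being 0 or 1, indicates whether [s] emits a
    unit. *)
Lemma card_detours : #|detours| = (\sum_(s < n) (n - s.+1) * b s)%N.
Proof.
have above (s : nat) m : (\sum_(w < m) (s < w) = m - s.+1)%N.
  by elim: m => [|m IHm]; rewrite ?big_ord0 // big_ord_recr /= IHm; lia.
under eq_bigr => s _ do rewrite -above big_distrl /=.
rewrite (pair_bigA _ (fun s w : 'I_n => (s < w) * b s)%N) /= -sum1_card big_mkcond.
apply: eq_bigr => -[s w] _; rewrite inE /=; have := b01 s.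
by case: (s < w)%N; case: (b s) => [|[]].
Qed.

End Paths.

Theorem mainTheorem1 (n : nat) (hn : (1 <= n)%N) (alpha : 'I_n -> nat)
    (halpha : forall i : 'I_n, alpha i = 0%N \/ alpha i = 1%N) :
  tesler_char_poly (fun k : 'I_n => alpha (rev_ord k)) =
  ('X - 1) ^+ (\sum_(i < n) i * alpha i)%N.
Proof.
have b01 s : (alpha (rev_ord s) <= 1)%N by case: (halpha (rev_ord s)) => ->.
(* The value of [rev_ord s] is [n - s.+1], so reversing the index turns the weights into [i]. *)
by rewrite tesler_char_polyE // card_detours // [in RHS](reindex_inj rev_ord_inj).
Qed.
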